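(* Let $\gamma\in(0,2)$. For all $\xi,\eta\in\mathbb{R}$, the kernel $\Phi_{\gamma,2}$ of the iterated carré du champ of $L_\gamma=-(-\Delta)^{\gamma/2}$ is the square of the carré du champ kernel $\Psi_\gamma$: $$\Phi_{\gamma,2}(\xi,\eta)=\bigl[\Psi_\gamma(\xi,\eta)\bigr]^2 .$$ Moreover, if $\xi\eta\ge 0$, then this equals $\bigl[R_{\gamma/2}(|\xi|,|\eta|)\bigr]^2$, where $R_{H}(s,t)=\tfrac12\bigl(|s|^{2H}+|t|^{2H}-|s-t|^{2H}\bigr)$ is the covariance of fractional Brownian motion with Hurst parameter $H$.
   Context: For $\gamma\in(0,2)$, $L_\gamma=-(-\Delta)^{\gamma/2}$ acts on exponentials by $L_\gamma(e^{i\xi x})=-|\xi|^\gamma e^{i\xi x}$. Its Lévy measure is $\nu_\gamma(dz)=c_\gamma|z|^{-1-\gamma}dz$ on $\mathbb{R}\setminus\{0\}$, with $c_\gamma>0$ normalized so that $|\xi|^\gamma=\int(1-\cos\xi z)\,\nu_\gamma(dz)$. The sesquilinear carré du champ is $$\Gamma(f,g)(x)=\tfrac12\int_{\mathbb{R}\setminus\{0\}}[f(x+z)-f(x)]\,\overline{[g(x+z)-g(x)]}\,\nu_\gamma(dz).$$ Its kernel $\Psi_\gamma$ is defined by $\Gamma(e^{i\xi\cdot},e^{i\eta\cdot})(x)=e^{i(\xi-\eta)x}\Psi_\gamma(\xi,\eta)$, and $\Psi_\gamma(\xi,\eta)=\tfrac12(|\xi|^\gamma+|\eta|^\gamma-|\xi-\eta|^\gamma)$.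 The iterated carré du champ (Hermitian-symmetrized) is $$\Gamma_2(f,g)=\tfrac12\bigl[L_\gamma(\Gamma(f,g))-\Gamma(f,L_\gamma g)-\Gamma(L_\gamma f,g)\bigr],$$ and its kernel $\Phi_{\gamma,2}$ is defined by $\Gamma_2(e^{i\xi\cdot},e^{i\eta\cdot})(x)=e^{i(\xi-\eta)x}\,\Phi_{\gamma,2}(\xi,\eta)$, so that for $f=\sum_n a_n e^{i\xi_n x}$ (finite sum) one has $\Gamma_2(f,f)(x)=\sum_{n,m}a_n\bar a_m\Phi_{\gamma,2}(\xi_n,\xi_m)e^{i(\xi_n-\xi_m)x}$. *)

(* Defs.v *)
From HB Require Import structures.
From mathcomp Require Import all_boot all_order all_algebra.
From mathcomp Require Import complex ring.
From mathcomp Require Import all_classical all_reals all_analysis.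
From mathcomp Require Import measurable_realfun.

Set Implicit Arguments.
Unset Strict Implicit.
Unset Printing Implicit Defensive.

Import Order.TTheory GRing.Theory Num.Theory.
Import numFieldNormedType.Exports.

Local Open Scope classical_set_scope.
Local Open Scope ring_scope.
Local Open Scope complex_scope.

Section FractionalLaplacian.
Context {R : realType}.

(** [c * |z|^(-1-gamma)], the density on [R \ {0}] of the Lévy measure with
    constant [c]. *)
Definition levy_density (gamma c z : R) : R := c * `|z| `^ (- 1 - gamma).

(** The integral is extended-real valued, so that the equation also asserts
    its finiteness. *)
Definition levy_normalized (gamma : R) : set R := [set c | 0 < c /\
  forall xi : R, (`|xi| `^ gamma)%:E =
    (\int[lebesgue_measure]_(z in [set z : R | z != 0%R])
       ((1 - cos (xi * z)) * levy_density gamma c z)%:E)%E].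

Definition levy_const (gamma : R) : R := xget 0 (levy_normalized gamma).

(** Integral of a complex-valued function over [R \ {0}] against
    [nu_gamma(dz) = c_gamma |z|^(-1-gamma) dz]. *)
Definition levy_integral (gamma : R) (f : R -> R[i]) : R[i] :=
  let w := levy_density gamma (levy_const gamma) in
  (\int[lebesgue_measure]_(z in [set z : R | z != 0]) (complex.Re (f z) * w z))
  +i*
  (\int[lebesgue_measure]_(z in [set z : R | z != 0]) (complex.Im (f z) * w z)).

(** [-(-Delta)^(gamma/2)], as the generator with symmetric Lévy measure
    [nu_gamma]. The second difference makes the integral absolutely convergent
    at [z = 0] for every [gamma] in [(0, 2)] and bounded [C^2] function [f]; it
    agrees with the principal value of the integral of [f (x + z) - f x]. *)
Definition Lgamma (gamma : R) (f : R -> R[i]) : R -> R[i] := fun x =>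
  2^-1 * levy_integral gamma (fun z => f (x + z) + f (x - z) - 2 * f x).

Definition carre_du_champ (gamma : R) (f g : R -> R[i]) : R -> R[i] := fun x =>
  2^-1 * levy_integral gamma
           (fun z => (f (x + z) - f x) * (g (x + z) - g x)^*).

Definition carre_du_champ2 (gamma : R) (f g : R -> R[i]) : R -> R[i] := fun x =>
  2^-1 * (Lgamma gamma (carre_du_champ gamma f g) x
          - carre_du_champ gamma f (Lgamma gamma g) x
          - carre_du_champ gamma (Lgamma gamma f) g x).

(** [x |-> e^(i xi x)]. *)
Definition expi (xi : R) : R -> R[i] := fun x => cos (xi * x) +i* sin (xi * x).

(** At most one [K] satisfies this, as exponentials do not vanish. *)
Definition is_kernel (B : (R -> R[i]) -> (R -> R[i]) -> R -> R[i]) :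
    set (R -> R -> R[i]) :=
  [set K | forall xi eta x : R,
     B (expi xi) (expi eta) x = expi (xi - eta) x * K xi eta].

Definition kernel_of (B : (R -> R[i]) -> (R -> R[i]) -> R -> R[i]) :
  R -> R -> R[i] := xget (fun _ _ => 0) (is_kernel B).

Definition Psi (gamma : R) : R -> R -> R[i] := kernel_of (carre_du_champ gamma).

Definition Phi2 (gamma : R) : R -> R -> R[i] :=
  kernel_of (carre_du_champ2 gamma).

(** Covariance of fractional Brownian motion with Hurst parameter [H]. *)
Definition fbm_cov (H s t : R) : R :=
  2^-1 * (`|s| `^ (2 * H) + `|t| `^ (2 * H) - `|s - t| `^ (2 * H)).

End FractionalLaplacian.

Lemma measurable_nz (R : realType) : measurable [set z : R | z != 0].
Proof.
rewrite [X in measurable X](_ : _ = ~` [set 0]); first exact: measurableC.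
by apply/seteqP; split => z /= => [/eqP//|/eqP].
Qed.

Lemma integrable_levy_density (R : realType) (gamma : R) (xi : R) :
  levy_normalized gamma (levy_const gamma) ->
  lebesgue_measure.-integrable [set z : R | z != 0]
   (EFin \o (fun z => (1 - cos (xi * z)) *
     levy_density gamma (levy_const gamma) z)).
Proof.
move=> [c0 H]; apply/integrableP; split.
  apply/measurable_EFinP.
  apply: measurable_funM.
    apply: measurable_funB; first exact: measurable_cst.
    apply: (@measurable_funTS); apply: continuous_measurable_fun => x.
    apply: continuous_comp; last exact: continuous_cos.
    exact: mulrl_continuous.
  apply: measurable_funM; first exact: measurable_cst.
  apply: (@measurable_funTS).
  apply: (@measurableT_comp _ _ _ _ _ _
    (fun y : R => y `^ (- 1 - gamma)) _ (@Num.norm R R)); first exact: measurable_powR.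
  exact: normr_measurable.
under eq_integral.
  move=> z _; rewrite /= ger0_norm; last first.
    apply: mulr_ge0; first by rewrite subr_ge0 cos_le1.
    by apply: mulr_ge0; [exact: ltW|exact: powR_ge0].
  over.
by rewrite -H ltry.
Qed.

(** The Fourier symbol of [-(-Delta)^(gamma/2)]. *)
Lemma Lgamma_expi (R : realType) (gamma : R) (xi x : R) :
  levy_normalized gamma (levy_const gamma) ->
  Lgamma gamma (expi xi) x = - (`|xi| `^ gamma)%:C * expi xi x.
Proof.
move=> Hn; have [c0 H] := Hn.
have I : \int[lebesgue_measure]_(z in [set z : R | z != 0])
    ((1 - cos (xi * z)) * levy_density gamma (levy_const gamma) z) = `|xi| `^ gamma.
  by rewrite /Rintegral -H.
rewrite /Lgamma /levy_integral.
under eq_Rintegral.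
  move=> z _.
  rewrite (_ : complex.Re _ * _ = - 2 * cos (xi * x) *
    ((1 - cos (xi * z)) * levy_density gamma (levy_const gamma) z)); last first.
    by rewrite /expi mulrDr mulrBr cosD cosB /=; ring.
  over.
rewrite RintegralZl//; [|exact: measurable_nz|exact: integrable_levy_density].
under [X in _ +i* X]eq_Rintegral.
  move=> z _.
  rewrite (_ : complex.Im _ * _ = - 2 * sin (xi * x) *
    ((1 - cos (xi * z)) * levy_density gamma (levy_const gamma) z)); last first.
    by rewrite /expi mulrDr mulrBr sinD sinB /=; ring.
  over.
rewrite RintegralZl//; [|exact: measurable_nz|exact: integrable_levy_density].
rewrite I /expi.
apply: (@mulfI _ 2); first by rewrite pnatr_eq0.
rewrite mulrA divff ?pnatr_eq0// mul1r.
by apply/eqP; rewrite eq_complex /=; apply/andP; split; apply/eqP; ring.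
Qed.

(* Main.v *)
Require Import Defs.
From mathcomp Require Import all_boot all_order all_algebra.
From mathcomp Require Import complex ring lra.
From mathcomp Require Import all_classical all_reals all_analysis.
From mathcomp Require Import measurable_realfun.
Import Order.TTheory GRing.Theory Num.Theory.
Import numFieldNormedType.Exports.
Local Open Scope classical_set_scope.
Local Open Scope ring_scope.
Local Open Scope complex_scope.
Set Implicit Arguments.
Unset Strict Implicit.
Unset Printing Implicit Defensive.

(** Exponentials diagonalize everything. On [e^(i xi .)] and [e^(i eta .)] the
    integrand of the carré du champ factors as [e^(i (xi - eta) x)] times
    [(e^(i xi z) - 1) * conj (e^(i eta z) - 1)], whose real part is
    [(1 - cos xi z) + (1 - cos eta z) - (1 - cos (xi - eta) z)] and whose
    imaginary part is odd in [z]. Integrating against the normalized Lévy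
    measure gives [carre_du_champ_expi]: the kernel is the real number
    [psi = (|xi|^gamma + |eta|^gamma - |xi - eta|^gamma) / 2].

    Since [psi] does not depend on [x], the function [Gamma (e_xi, e_eta)] is
    the multiple [psi * e_(xi - eta)] of an exponential, so [L] multiplies it by
    [- |xi - eta|^gamma], while [L] in either argument of [Gamma] multiplies the
    result by [- |xi|^gamma] or [- |eta|^gamma]. Hence the kernel of [Gamma_2]
    is [psi * (|xi|^gamma + |eta|^gamma - |xi - eta|^gamma) / 2 = psi^2]
    ([carre_du_champ2_kernel]). The fractional Brownian form follows because
    [|xi - eta| = ||xi| - |eta||] when [xi] and [eta] have the same sign.

    The analytic content is that a normalizing constant exists
    ([levy_normalized_const]), so that the default value in the definition of
    [levy_const] is never taken. The substitution [z |-> xi z] shows that the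
    integral of [(1 - cos xi z) |z|^(-1-gamma)] is [|xi|^gamma] times its value
    at [xi = 1] ([levy_symbol_scale]). That value is positive, and it is finite
    because [1 - cos z] is at most [z^2] near [0], where [gamma < 2] gives
    integrability, and at most [2] at infinity, where [gamma > 0] does. *)

(** * Scaling of Lebesgue measure *)

Lemma measurable_mulrl (R : realType) (a : R) :
  measurable_fun [set: measurableTypeR R] ( *%R a : _ -> measurableTypeR R).
Proof. by apply: continuous_measurable_fun; exact: mulrl_continuous. Qed.

(** By uniqueness of Lebesgue measure, it is enough to compare [|a|] times the
    image measure with Lebesgue measure on half-open intervals, whose preimages
    are intervals scaled by [1 / a] (and reversed if [a < 0]). *)
Lemma lebesgue_measure_scale (R : realType) (a : R) (A : set R) : a != 0 ->
  measurable A ->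
  pushforward lebesgue_measure ( *%R a : _ -> measurableTypeR R) A =
  (`|a|^-1%:E * lebesgue_measure A)%E.
Proof.
move=> a0 mA.
have na : 0 <= `|a| by [].
have a0' : `|a| != 0 by rewrite normr_eq0.
pose m := mscale (NngNum na)
   (pushforward lebesgue_measure ( *%R a : _ -> measurableTypeR R)).
rewrite (@lebesgue_measure_unique _ (m (@measurable_mulrl R a)) _ A)//.
  by rewrite /m /mscale/= muleA -EFinM mulVf// mul1e.
move=> _ [[u v]] _ <-.
rewrite lebesgue_measure_itv/= /m /mscale /pushforward /= lte_fin.
have [a_gt0|a_lt0|/eqP] := ltgtP 0 a; last by rewrite eq_sym (negbTE a0).
- rewrite [X in (_ * lebesgue_measure X)%E](_ : _ = `]u / a, v / a]%classic).
    rewrite lebesgue_measure_itv/= lte_fin ltr_pM2r ?invr_gt0//.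
    case: ifPn => _; last by rewrite mule0.
    by rewrite gtr0_norm// -!EFinD -EFinM; congr EFin; field.
  apply/seteqP; split => x /=; rewrite !in_itv/=.
    by rewrite ltr_pdivrMr// ler_pdivlMr// mulrC.
  by rewrite ltr_pdivrMr// ler_pdivlMr// mulrC.
- rewrite [X in (_ * lebesgue_measure X)%E](_ : _ = `[v / a, u / a[%classic).
    rewrite lebesgue_measure_itv/= lte_fin ltr_nM2r ?invr_lt0//.
    case: ifPn => _; last by rewrite mule0.
    by rewrite ltr0_norm// -!EFinD -EFinM; congr EFin; field.
  apply/seteqP; split => x /=; rewrite !in_itv/=.
    by rewrite andbC ltr_ndivlMr// ler_ndivrMr// mulrC.
  by rewrite andbC ltr_ndivlMr// ler_ndivrMr// mulrC.
Qed.

Lemma ge0_integral_scale (R : realType) (a : R) (D : set R) (f : R -> \bar R) :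
  a != 0 -> measurable D -> measurable_fun D f ->
  (forall x, D x -> (0 <= f x)%E) ->
  (\int[lebesgue_measure]_(x in ( *%R a @^-1` D)) f (a * x)%R =
   `|a|^-1%:E * \int[lebesgue_measure]_(x in D) f x)%E.
Proof.
move=> a0 mD mf f0.
rewrite -(ge0_integral_pushforward (@measurable_mulrl R a)
  lebesgue_measure mD mf)//; last by move=> x /set_mem; exact: f0.
have na : 0 <= `|a|^-1 by rewrite invr_ge0.
rewrite -(ge0_integral_mscale lebesgue_measure mD (NngNum na) mf f0).
apply: eq_measure_integral => A mA _.
exact: lebesgue_measure_scale.
Qed.

Lemma preimage_scale_nz (R : realType) (a : R) : a != 0 ->
  *%R a @^-1` [set z : R | z != 0] = [set z : R | z != 0].
Proof.
by move=> a0; apply/seteqP; split=> x /=; rewrite mulf_eq0 (negbTE a0).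
Qed.

(** The reflection [z |-> - z] exchanges the positive and negative parts of an
    odd function, so they have the same integral. *)
Lemma Rintegral_odd_nz (R : realType) (f : R -> R) :
  measurable_fun [set z : R | z != 0] f ->
  (forall z, f (- z) = - f z) ->
  \int[lebesgue_measure]_(z in [set z : R | z != 0]) f z = 0.
Proof.
move=> mf odd; rewrite /Rintegral integralE.
set p := (X in (X - _)%E); set n := (X in (_ - X)%E).
(* If both integrals are infinite, the difference is [-oo] and [fine] makes it 0. *)
suff -> : n = p by case: p => [r| |] //=; rewrite subrr.
have n1 : -1 != 0 :> R by rewrite oppr_eq0 oner_eq0.
have := @ge0_integral_scale R (-1) _ ((EFin \o f)^\+)%E n1 (@measurable_nz R).
rewrite normrN1 invr1 mul1e preimage_scale_nz// -/p => <-.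
- apply: eq_integral => z _.
  by rewrite mulN1r funeposE funenegE /= odd.
- by apply: measurable_funepos; exact/measurable_EFinP.
- by move=> x _; exact: funepos_ge0.
Qed.

Lemma ge0_integral_nz_even (R : realType) (f : R -> \bar R) :
  measurable_fun setT f ->
  (forall z, 0 <= f z)%E -> (forall z, f (- z) = f z) ->
  (\int[lebesgue_measure]_(z in [set z : R | z != 0%R]) f z =
   \int[lebesgue_measure]_(z in `]0%R, +oo[) f z +
   \int[lebesgue_measure]_(z in `]0%R, +oo[) f z)%E.
Proof.
move=> mf f0 even.
rewrite (_ : [set z : R | z != 0%R] = `]0%R, +oo[ `|` `]-oo, 0%R[); last first.
  apply/seteqP; split=> x /=; rewrite !in_itv/= andbT neq_lt.
    by move=> /orP[]; [right|left].
  by move=> [->|->//]; rewrite orbT.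
rewrite ge0_integral_setU//; [|exact: measurable_funTS|]; last first.
  apply/disj_setPS => x []/=; rewrite !in_itv/= andbT => /lt_trans /[apply].
  by rewrite ltxx.
have n1 : -1 != 0 :> R by rewrite oppr_eq0 oner_eq0.
congr (_ + _)%E.
have := @ge0_integral_scale R (-1) `]0%R, +oo[%classic f n1.
rewrite normrN1 invr1 mul1e => <- //; last exact: measurable_funTS.
rewrite (_ : _ @^-1` _ = `]-oo, 0%R[%classic); last first.
  by apply/seteqP; split=> x /=; rewrite !in_itv/= andbT mulN1r oppr_gt0.
by apply: eq_integral => x _; rewrite mulN1r even.
Qed.

(** * Integrals of powers at zero and at infinity *)

Lemma is_derive_powR_primitive (R : realType) (p x : R) : p != 0 -> 0 < x ->
  is_derive x 1 (fun z : R => p^-1 * z `^ p) (x `^ (p - 1)).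
Proof.
move=> p0 x0.
have -> : x `^ (p - 1) = p^-1 *: (p * x `^ (p - 1)).
  by rewrite scalerA mulVf// scale1r.
by apply: is_deriveZ; exact: is_derive1_powR.
Qed.

Lemma continuous_powR_gt0 (R : realType) (q x : R) : 0 < x ->
  {for x, continuous (fun z : R => z `^ q)}.
Proof.
move=> x0; apply/differentiable_continuous/derivable1_diffP.
by apply: derivable_powR; rewrite in_itv/= x0.
Qed.

Lemma integral_powR_itv (R : realType) (p a b : R) : p != 0 -> 0 < a -> a < b ->
  (\int[lebesgue_measure]_(z in `[a, b]) (z `^ (p - 1))%:E =
   ((b `^ p - a `^ p) / p)%:E)%E.
Proof.
move=> p0 a0 ab.
rewrite (@continuous_FTC2 _ _ (fun z => p^-1 * z `^ p))//.
- by rewrite -EFinB; congr EFin; field.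
- apply: continuous_in_subspaceT => x /set_mem /=.
  rewrite in_itv/= => /andP[ax _].
  by apply: continuous_powR_gt0; exact: lt_le_trans ax.
- split.
  + move=> x; rewrite in_itv/= => /andP[ax _].
    have x0 := lt_trans a0 ax.
    by have /@ex_derive := is_derive_powR_primitive p0 x0.
  + by apply: cvg_at_right_filter; apply: cvgMl_tmp; exact: continuous_powR_gt0.
  + apply: cvg_at_left_filter; apply: cvgMl_tmp; apply: continuous_powR_gt0.
    exact: lt_trans ab.
- move=> x; rewrite in_itv/= => /andP[ax _].
  have x0 := lt_trans a0 ax.
  by rewrite derive1E; have /@derive_val -> := is_derive_powR_primitive p0 x0.
Qed.

Lemma measurable_EFin_powR (R : realType) (p : R) (D : set R) :
  measurable_fun D (fun z => (z `^ p)%:E).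
Proof.
by apply/measurable_EFinP; apply: measurable_funTS; exact: measurable_powR.
Qed.

Lemma ge0_integral_bigcup_le (R : realType) (F : (set R)^nat) (f : R -> \bar R)
    (M : \bar R) :
  nondecreasing_seq F -> (forall n, measurable (F n)) ->
  measurable_fun setT f -> (forall n x, F n x -> (0 <= f x)%E) ->
  (forall n, \int[lebesgue_measure]_(x in F n) f x <= M)%E ->
  (\int[lebesgue_measure]_(x in \bigcup_n F n) f x <= M)%E.
Proof.
move=> ndF mF mf f0 fM.
have cvgF : (\int[lebesgue_measure]_(x in F n) f x @[n --> \oo] -->
    \int[lebesgue_measure]_(x in \bigcup_n F n) f x)%E.
  apply: ge0_nondecreasing_set_cvg_integral => // n.
  exact: measurable_funTS.
rewrite -(cvg_lim _ cvgF)//; apply: lime_le; last exact: nearW.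
by apply/cvg_ex; eexists; exact: cvgF.
Qed.

Lemma integral_powR_01 (R : realType) (p : R) : 0 < p ->
  (\int[lebesgue_measure]_(z in `]0%R, 1%R]) (z `^ (p - 1))%:E <= (p^-1)%:E)%E.
Proof.
move=> p0; rewrite (itv_open_bnd_bigcup false (1 : R) 0).
apply: ge0_integral_bigcup_le => //.
- move=> m n mn; apply/subsetPset => x /=; rewrite !in_itv/= !add0r.
  move=> /andP[mx ->]; rewrite andbT (le_trans _ mx)//.
  by rewrite lef_pV2 ?posrE// ler_nat.
- exact: measurable_EFin_powR.
- by move=> n x _; rewrite lee_fin powR_ge0.
- move=> n; rewrite add0r.
  have [->|n0] := eqVneq n 0%N.
    by rewrite invr1 set_itv1 integral_set1 lee_fin invr_ge0 ltW.
  rewrite integral_powR_itv ?gt_eqF//; last first.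
    by rewrite invf_lt1// ltr1n ltnS lt0n.
  by rewrite lee_fin powR1 mulrBl mul1r gerBl divr_ge0 ?powR_ge0 ?ltW.
Qed.

Lemma integral_powR_1y (R : realType) (p : R) : p < 0 ->
  (\int[lebesgue_measure]_(z in `[1%R, +oo[) (z `^ (p - 1))%:E <=
   (- p^-1)%:E)%E.
Proof.
move=> p0; rewrite itv_bndy_bigcup_BRight.
apply: ge0_integral_bigcup_le => //.
- move=> m n mn; apply/subsetPset => x /=; rewrite !in_itv/=.
  by move=> /andP[-> xm]; rewrite (le_trans xm)// lerD2l ler_nat.
- exact: measurable_EFin_powR.
- by move=> n x _; rewrite lee_fin powR_ge0.
- move=> [|n].
    by rewrite addr0 set_itv1 integral_set1 lee_fin oppr_ge0 invr_le0 ltW.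
  rewrite integral_powR_itv ?lt_eqF ?ltrDl//.
  rewrite lee_fin powR1 mulrBl mul1r gerDr.
  by rewrite mulr_ge0_le0 ?powR_ge0// invr_le0 ltW.
Qed.

(** * Existence of the normalizing constant *)

Section LevyDensity.
Context {R : realType}.
Implicit Types gamma : R.

Lemma one_sub_cos_ge0 (x : R) : 0 <= 1 - cos x.
Proof. by rewrite subr_ge0 cos_le1. Qed.

Lemma one_sub_cos_le2 (x : R) : 1 - cos x <= 2.
Proof. by have := cos_geN1 x; lra. Qed.

Lemma sin_le_id (x : R) : 0 < x -> sin x <= x.
Proof.
move=> x0.
have [c _ ] := @MVT R sin cos 0 x x0 (fun z _ => is_derive_sin z)
  (continuous_subspaceT (@continuous_sin R)).
rewrite sin0 !subr0 => ->.
by rewrite ler_piMl ?cos_le1// ltW.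
Qed.

Lemma one_sub_cos_le_sqr (x : R) : 0 < x -> 1 - cos x <= x ^+ 2.
Proof.
move=> x0.
have [c /andP[]] := @MVT R cos (fun z => - sin z) 0 x x0
  (fun z _ => is_derive_cos z) (continuous_subspaceT (@continuous_cos R)).
rewrite !bnd_simp => c0 cx; rewrite cos0 !subr0 => cosx.
have := sin_le_id c0; nra.
Qed.

Lemma measurable_levy_density gamma c (D : set R) :
  measurable_fun D (levy_density gamma c).
Proof.
apply: measurable_funTS; apply: measurable_funM; first exact: measurable_cst.
apply: (@measurableT_comp _ _ _ _ _ _
    (fun y : R => y `^ (- 1 - gamma)) _ (@Num.norm R R)).
  exact: measurable_powR.
exact: normr_measurable.
Qed.

Lemma levy_densityN gamma c z :
  levy_density gamma c (- z) = levy_density gamma c z.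
Proof. by rewrite /levy_density normrN. Qed.

Lemma levy_density_ge0 gamma c z : 0 <= c -> 0 <= levy_density gamma c z.
Proof. by move=> c0; rewrite mulr_ge0 ?powR_ge0. Qed.

(** The value at [xi] of the Fourier symbol of the operator with Lévy measure
    [c |z|^(-1-gamma) dz], up to sign. *)
Definition levy_symbol gamma c xi : \bar R :=
  (\int[lebesgue_measure]_(z in [set z : R | z != 0%R])
       ((1 - cos (xi * z)) * levy_density gamma c z)%:E)%E.

Lemma measurable_one_sub_cos_levy gamma c (xi : R) (D : set R) :
  measurable_fun D (fun z => (1 - cos (xi * z)) * levy_density gamma c z).
Proof.
apply: measurable_funM; last exact: measurable_levy_density.
apply: measurable_funB; first exact: measurable_cst.
apply: measurable_funTS; apply: continuous_measurable_fun => x.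
by apply: continuous_comp; [exact: mulrl_continuous|exact: continuous_cos].
Qed.

(** Substitute [y = xi z]: by homogeneity of degree [-1 - gamma], the density
    contributes [|xi|^(1 + gamma)], and [dz] contributes [|xi|^-1]. *)
Lemma levy_symbol_scale gamma c xi : 0 <= c -> xi != 0 ->
  levy_symbol gamma c xi = ((`|xi| `^ gamma)%:E * levy_symbol gamma c 1)%E.
Proof.
move=> c0 xi0.
have nxi0 : `|xi| != 0 by rewrite normr_eq0.
pose h z := ((1 - cos (1 * z)) * levy_density gamma c z)%:E.
have h0 xi' z : (0 <= ((1 - cos (xi' * z)) * levy_density gamma c z)%:E)%E.
  by rewrite lee_fin mulr_ge0 ?one_sub_cos_ge0 ?levy_density_ge0.
have := @ge0_integral_scale R xi [set z : R | z != 0] h xi0 (@measurable_nz R).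
rewrite preimage_scale_nz// => H.
transitivity ((`|xi| `^ (1 + gamma))%:E *
    \int[lebesgue_measure]_(z in [set z : R | z != 0%R]) h (xi * z)%R)%E.
  rewrite -ge0_integralZl_EFin ?powR_ge0//;
    [|exact: measurable_nz|by move=> *; exact: h0|].
    apply: eq_integral => z _.
    rewrite /h /levy_density -EFinM mul1r normrM powRM//; congr EFin.
    rewrite [RHS](_ : _ = (`|xi| `^ (1 + gamma) * `|xi| `^ (- 1 - gamma)) *
      ((1 - cos (xi * z)) * (c * `|z| `^ (- 1 - gamma)))); last by ring.
    rewrite -powRD ?nxi0 ?implybT//.
    by rewrite (_ : 1 + gamma + (- 1 - gamma) = 0) ?powRr0 ?mul1r//; ring.
  apply/measurable_EFinP.
  apply: (@measurableT_comp _ _ _ _ _ _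
    (fun y : R => (1 - cos (1 * y)) * levy_density gamma c y)).
    exact: measurable_one_sub_cos_levy.
  exact: measurable_funTS (@measurable_mulrl R xi).
rewrite H//.
- by rewrite muleA -EFinM powRD ?nxi0 ?implybT// powRr1// mulrAC divff// mul1r.
- by apply/measurable_EFinP; exact: measurable_one_sub_cos_levy.
- by move=> x _; exact: h0.
Qed.

(** The integrand is even, so only [z > 0] matters. It is at most
    [c z^(1 - gamma)] on [(0, 1]] and at most [2 c z^(-1 - gamma)] beyond, and
    these powers are integrable there as [gamma < 2] and [gamma > 0]. *)
Lemma levy_symbol_lty gamma c : 0 < gamma < 2 -> 0 <= c ->
  (levy_symbol gamma c 1 < +oo)%E.
Proof.
move=> /andP[g0 g2] c0.
have h0 z : 0 <= (1 - cos (1 * z)) * levy_density gamma c z.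
  by rewrite mulr_ge0 ?one_sub_cos_ge0 ?levy_density_ge0.
have mh D := measurable_one_sub_cos_levy gamma c 1 D.
rewrite /levy_symbol ge0_integral_nz_even//; last 2 first.
- by apply/measurable_EFinP; exact: mh.
- by move=> z; rewrite levy_densityN mulrN cosN.
suff half_lty : (\int[lebesgue_measure]_(z in `]0%R, +oo[)
    ((1 - cos (1 * z)) * levy_density gamma c z)%:E < +oo)%E.
  by rewrite lte_add_pinfty.
rewrite (@itv_bndbnd_setU _ _ _ (BRight 1)) ?bnd_simp//.
rewrite ge0_integral_setU//; first last.
- apply/disj_setPS => x []/=; rewrite !in_itv/= andbT => /andP[_ x1].
  by move=> /(le_lt_trans x1); rewrite ltxx.
- by move=> x _; rewrite lee_fin.
- by apply/measurable_EFinP; exact: mh.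
have p01 : 0 < 2 - gamma by rewrite subr_gt0.
have p1y : - gamma < 0 by rewrite oppr_lt0.
apply: lte_add_pinfty.
- apply: (@le_lt_trans _ _ (\int[lebesgue_measure]_(z in `]0%R, 1%R])
     (c%:E * (z `^ (2 - gamma - 1))%:E))%E).
    apply: ge0_le_integral => //.
    + by move=> z _; rewrite lee_fin.
    + by apply/measurable_EFinP; exact: mh.
    + by apply: measurable_funeM; exact: measurable_EFin_powR.
    + move=> z /=; rewrite in_itv/= => /andP[z0 _].
      rewrite -EFinM lee_fin /levy_density gtr0_norm// mul1r mulrCA ler_wpM2l//.
      rewrite (_ : 2 - gamma - 1 = 2%:R + (- 1 - gamma)); last by ring.
      rewrite (@powRD _ _ 2) ?(gt_eqF z0) ?implybT//.
      rewrite powR_mulrn ?(ltW z0)// ler_wpM2r ?powR_ge0//.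
      exact: one_sub_cos_le_sqr.
  rewrite ge0_integralZl_EFin//; last exact: measurable_EFin_powR.
    apply: lte_mul_pinfty; rewrite ?lee_fin//.
    by apply: le_lt_trans (integral_powR_01 p01) _; exact: ltry.
  by move=> z _; rewrite lee_fin powR_ge0.
- rewrite integral_itv_obnd_cbnd; last by apply/measurable_EFinP; exact: mh.
  apply: (@le_lt_trans _ _ (\int[lebesgue_measure]_(z in `[1%R, +oo[)
     ((c * 2)%:E * (z `^ (- gamma - 1))%:E))%E).
    apply: ge0_le_integral => //.
    + by move=> z _; rewrite lee_fin.
    + by apply/measurable_EFinP; exact: mh.
    + by apply: measurable_funeM; exact: measurable_EFin_powR.
    + move=> z /=; rewrite in_itv/= andbT => z1.
      have z0 : 0 < z := lt_le_trans ltr01 z1.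
      rewrite -EFinM lee_fin /levy_density gtr0_norm// mulrCA -mulrA.
      rewrite ler_wpM2l//.
      by rewrite (addrC (- 1)) ler_wpM2r ?powR_ge0 ?one_sub_cos_le2.
  rewrite ge0_integralZl_EFin//; last 2 first.
  + exact: measurable_EFin_powR.
  + by rewrite mulr_ge0.
  + apply: lte_mul_pinfty; rewrite ?lee_fin// ?mulr_ge0//.
    by apply: le_lt_trans (integral_powR_1y p1y) _; exact: ltry.
  + by move=> z _; rewrite lee_fin powR_ge0.
Qed.

(** Otherwise the nonnegative integrand would vanish almost everywhere; but it
    is positive on [[1, 2]], as [cos < 1] on [(0, pi]] and [2 <= pi]. *)
Lemma levy_symbol_gt0 gamma c : 0 < c -> (0 < levy_symbol gamma c 1)%E.
Proof.
move=> c0.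
have h0 z : 0 <= (1 - cos (1 * z)) * levy_density gamma c z.
  by rewrite mulr_ge0 ?one_sub_cos_ge0 ?levy_density_ge0 ?ltW.
have mh D := measurable_one_sub_cos_levy gamma c 1 D.
rewrite lt_neqAle integral_ge0 ?andbT; last by move=> z _; rewrite lee_fin.
apply/negP => /eqP/esym int0.
have meh := (@measurable_EFinP _ _ _ _ _).2 (mh [set z : R | z != 0]).
have int_norm0 :
  (\int[lebesgue_measure]_(z in [set z : R | z != 0%R])
   `|((1 - cos (1 * z)) * levy_density gamma c z)%:E|)%E = 0%E.
  by rewrite -[RHS]int0; apply: eq_integral => z _; rewrite gee0_abs// lee_fin.
have [N [mN N0 hN]] :=
  (ae_eq_integral_abs lebesgue_measure (@measurable_nz R) meh).1 int_norm0.
have sub : `[1, 2]%classic `<=` N.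
  move=> z /=; rewrite in_itv/= => /andP[z1 z2]; apply: hN => /=.
  have z0 : 0 < z := lt_le_trans ltr01 z1.
  move=> /(_ (lt0r_neq0 z0)) [] /eqP; apply/negP/lt0r_neq0.
  rewrite mul1r mulr_gt0//; last first.
    by rewrite mulr_gt0// powR_gt0// normr_gt0 gt_eqF.
  rewrite subr_gt0 -[ltRHS]cos0.
  by rewrite ltr_cos ?in_itv/= ?lexx ?pi_ge0// ltW//= (le_trans z2)// pi_ge2.
have : (lebesgue_measure (`[1%R, 2%R] : set R) <= lebesgue_measure N)%E.
  by apply: le_measure => //; rewrite inE.
by rewrite lebesgue_measure_itv/= N0 lte_fin ltr1n -EFinB lee_fin; lra.
Qed.

Lemma levy_symbol_linear gamma c xi : 0 <= c ->
  levy_symbol gamma c xi = (c%:E * levy_symbol gamma 1 xi)%E.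
Proof.
move=> c0; rewrite /levy_symbol -ge0_integralZl_EFin//.
- apply: eq_integral => z _; rewrite /levy_density -EFinM; congr EFin; ring.
- exact: measurable_nz.
- by move=> z _; rewrite lee_fin mulr_ge0 ?one_sub_cos_ge0 ?levy_density_ge0.
- by apply/measurable_EFinP; exact: measurable_one_sub_cos_levy.
Qed.

(** The constant is the inverse of the symbol at [xi = 1] with [c = 1]. *)
Lemma levy_normalized_const gamma : 0 < gamma < 2 ->
  levy_normalized gamma (levy_const gamma).
Proof.
move=> g02; have /andP[g0 _] := g02.
apply: xgetPex.
have I0 := levy_symbol_gt0 gamma (@ltr01 R).
have Ioo := levy_symbol_lty g02 (@ler01 R).
have Ifin : levy_symbol gamma 1 1 \is a fin_num.
  by rewrite ge0_fin_numE// ltW.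
set I := fine (levy_symbol gamma 1 1).
have Ipos : 0 < I by rewrite fine_gt0// I0.
exists I^-1; split; first by rewrite invr_gt0.
move=> xi; rewrite -/(levy_symbol gamma I^-1 xi).
have [->|xi0] := eqVneq xi 0.
  rewrite normr0 powR0 ?gt_eqF//; apply/esym/integral0_eq => z _.
  by rewrite mul0r cos0 subrr mul0r.
rewrite levy_symbol_scale ?invr_ge0 ?ltW//.
rewrite levy_symbol_linear ?invr_ge0 ?ltW// -(fineK Ifin) -/I.
rewrite -!EFinM mulVf ?mulr1//.
by rewrite gt_eqF.
Qed.

End LevyDensity.

(** * Complex exponentials *)

Section Exponentials.
Context {R : realType}.
Implicit Types xi eta x : R.

Lemma expi0 xi : expi xi 0 = 1.
Proof. by rewrite /expi mulr0 cos0 sin0. Qed.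

Lemma expiD xi x z : expi xi (x + z) = expi xi x * expi xi z.
Proof.
by rewrite /expi mulrDr cosD sinD; apply/eqP; rewrite eq_complex/= eqxx/= addrC.
Qed.

Lemma expi_mul_conj xi eta x : expi xi x * (expi eta x)^* = expi (xi - eta) x.
Proof.
rewrite /expi mulrBl cosB sinB; apply/eqP; rewrite eq_complex/=.
by apply/andP; split; apply/eqP; ring.
Qed.

(** Exhibits an exponential as a multiple of itself, the form in which the
    operators below are computed. *)
Lemma expi_mul1 xi : expi xi = (fun y => 1 * expi xi y).
Proof. by apply/funext => y; rewrite mul1r. Qed.

End Exponentials.

Lemma is_kernel_unique (R : realType)
    (B : (R -> R[i]) -> (R -> R[i]) -> R -> R[i]) K :
  is_kernel B K -> kernel_of B = K.
Proof.
move=> BK; apply: xget_unique => // K' BK'.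
apply/funext => xi; apply/funext => eta.
by have := BK' xi eta 0; rewrite BK !expi0 !mul1r.
Qed.

(** * The carré du champ on exponentials *)

Section CarreDuChamp.
Context {R : realType} (gamma : R) (gamma_gt0 : 0 < gamma).
Context (normalized : levy_normalized gamma (levy_const gamma)).
Let w := levy_density gamma (levy_const gamma).
Let mu := @lebesgue_measure R.
Let nz := [set z : R | z != 0].

Let mnz : measurable (nz : set (measurableTypeR R)).
Proof. exact: measurable_nz. Qed.

Definition levy_integrable (f : R -> R[i]) :=
  mu.-integrable nz (EFin \o (fun z => complex.Re (f z) * w z)) /\
  mu.-integrable nz (EFin \o (fun z => complex.Im (f z) * w z)).

(** Multiplication by a complex [k] mixes the real and imaginary parts of [f];
    integrability lets their integrals be recombined. *)
Lemma levy_integralZ (k : R[i]) f : levy_integrable f ->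
  levy_integral gamma (fun z => k * f z) = k * levy_integral gamma f.
Proof.
case: k => a b [iR iI]; rewrite /levy_integral -/w.
have iZ (c : R) (g : R -> R) : mu.-integrable nz (EFin \o g) ->
  mu.-integrable nz (EFin \o (fun z => c * g z)).
  exact: integrableZl.
apply/eqP; rewrite eq_complex; apply/andP; split; apply/eqP => /=.
- rewrite -!RintegralZl// -RintegralB//; [|exact: iZ|exact: iZ].
  by apply: eq_Rintegral => z _; case: (f z) => u v /=; ring.
- rewrite -!RintegralZl// -RintegralD//; [|exact: iZ|exact: iZ].
  by apply: eq_Rintegral => z _; case: (f z) => u v /=; ring.
Qed.

Lemma Rintegral_one_sub_cos xi :
  \int[lebesgue_measure]_(z in nz) ((1 - cos (xi * z)) * w z) = `|xi| `^ gamma.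
Proof. by have [_ H] := normalized; rewrite /Rintegral -H. Qed.

(** The integrand of the carré du champ of two exponentials at [x = 0]. *)
Definition increment_product (xi eta z : R) : R[i] :=
  (expi xi z - 1) * (expi eta z - 1)^*.

Lemma Re_increment_product xi eta z :
  complex.Re (increment_product xi eta z) =
  (1 - cos (xi * z)) + (1 - cos (eta * z)) - (1 - cos ((xi - eta) * z)).
Proof.
by rewrite /increment_product /expi [(xi - eta) * z]mulrBl cosB /=; ring.
Qed.

Lemma Im_increment_product xi eta z :
  complex.Im (increment_product xi eta z) =
  sin (eta * z) * (1 - cos (xi * z)) - sin (xi * z) * (1 - cos (eta * z)).
Proof. by rewrite /increment_product /expi /=; ring. Qed.

(** Up to sign, the second difference of an exponential at [0]: this lets the
    generator be computed from the same integral as the carré du champ. *)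
Lemma increment_product_diag xi z :
  increment_product xi xi z = 2 - expi xi z - expi xi (- z).
Proof.
apply/eqP; rewrite eq_complex; apply/andP; split; apply/eqP.
  by rewrite Re_increment_product subrr mul0r cos0 /expi mulrN cosN /=; ring.
by rewrite Im_increment_product /expi mulrN sinN /=; ring.
Qed.

(** The normalization of the Lévy measure makes every [1 - cos (t z)] integrable.
    The real part is a combination of three such functions, and the imaginary
    part is at most [(1 - cos xi z) + (1 - cos eta z)] in absolute value. *)
Lemma levy_integrable_increment_product xi eta :
  levy_integrable (increment_product xi eta).
Proof.
have iC (t : R) := integrable_levy_density t normalized.
have w0 z : 0 <= w z by apply: levy_density_ge0; apply/ltW; case: normalized.
split.
- have := integrableB mnz (integrableD mnz (iC xi) (iC eta)) (iC (xi - eta)).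
  apply: eq_integrable => // z _.
  transitivity (complex.Re (increment_product xi eta z) * w z)%:E; last by [].
  rewrite Re_increment_product /= -!EFinD.
  by congr EFin; rewrite /w; ring.
- apply: le_integrable (integrableD mnz (iC xi) (iC eta)) => //.
    apply/measurable_EFinP; apply: measurable_funM; last first.
      exact: measurable_levy_density.
    rewrite (_ : (fun z => _) = (fun z => sin (eta * z) * (1 - cos (xi * z)) -
      sin (xi * z) * (1 - cos (eta * z)))); last first.
      by apply/funext => z; rewrite Im_increment_product.
    have ms t : measurable_fun nz (fun z : R => sin (t * z)).
      apply: measurable_funTS; apply: continuous_measurable_fun => z.
      by apply: continuous_comp; [exact: mulrl_continuous|exact: continuous_sin].
    have mc t : measurable_fun nz (fun z : R => 1 - cos (t * z)).
      apply: measurable_funB; first exact: measurable_cst.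
      apply: measurable_funTS; apply: continuous_measurable_fun => z.
      by apply: continuous_comp; [exact: mulrl_continuous|exact: continuous_cos].
    apply: measurable_funB; apply: measurable_funM;
      [exact: ms|exact: mc|exact: ms|exact: mc].
  move=> z _; rewrite [in leLHS]/comp Im_increment_product /=.
  rewrite lee_fin -mulrDl normrM [leRHS]normrM ler_wpM2r//.
  rewrite [leRHS]ger0_norm; last by apply: addr_ge0; exact: one_sub_cos_ge0.
  rewrite (le_trans (ler_normB _ _))// !normrM lerD//.
    rewrite [`|1 - _|]ger0_norm ?one_sub_cos_ge0//.
    by rewrite ler_piMl ?one_sub_cos_ge0 ?sin_max.
  rewrite [`|1 - _|]ger0_norm ?one_sub_cos_ge0//.
  by rewrite ler_piMl ?one_sub_cos_ge0 ?sin_max.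
Qed.

Definition carre_du_champ_symbol (xi eta : R) : R :=
  2^-1 * (`|xi| `^ gamma + `|eta| `^ gamma - `|xi - eta| `^ gamma).

(** The real part is computed by the normalization of the Lévy measure; the
    imaginary part is odd, so that it contributes nothing. *)
Lemma levy_integral_increment_product xi eta :
  levy_integral gamma (increment_product xi eta) =
  (2 * carre_du_champ_symbol xi eta)%:C.
Proof.
have iC (t : R) := integrable_levy_density t normalized.
have [_ iI] := levy_integrable_increment_product xi eta.
rewrite /levy_integral -/w.
transitivity ((2 * carre_du_champ_symbol xi eta) +i* 0); last by [].
congr Complex.
- rewrite /carre_du_champ_symbol mulrA divff ?pnatr_eq0// mul1r.
  rewrite -!Rintegral_one_sub_cos.
  rewrite -RintegralD// -RintegralB//; last first.
    exact: (integrableD mnz (iC xi) (iC eta)).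
  by apply: eq_Rintegral => z _; rewrite Re_increment_product; ring.
- apply: Rintegral_odd_nz; first by case/integrableP: iI => /measurable_EFinP.
  move=> z; rewrite /w levy_densityN !Im_increment_product.
  by rewrite !mulrN !sinN !cosN; ring.
Qed.

(** The scalars [a] and [b] are there because [Gamma_2] applies [Gamma] to images
    of exponentials under the generator. *)
Lemma carre_du_champ_expi (a b : R[i]) xi eta x :
  carre_du_champ gamma (fun y => a * expi xi y) (fun y => b * expi eta y) x =
  a * b^* * expi (xi - eta) x * (carre_du_champ_symbol xi eta)%:C.
Proof.
rewrite /carre_du_champ.
rewrite (_ : (fun z => _) = (fun z =>
    (a * b^* * expi (xi - eta) x) * increment_product xi eta z)); last first.
  apply/funext => z; rewrite !expiD -expi_mul_conj /increment_product.
  by rewrite !(rmorphB, rmorphM, rmorph1)/=; ring.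
rewrite levy_integralZ ?levy_integral_increment_product//; last first.
  exact: levy_integrable_increment_product.
by rewrite rmorphM/= rmorph_nat; field.
Qed.

(** The scalar [k] is there because [Gamma_2] applies the generator to the carré
    du champ of two exponentials, which is a multiple of an exponential. *)
Lemma Lgamma_expiZ (k : R[i]) xi x :
  Lgamma gamma (fun y => k * expi xi y) x =
  - (`|xi| `^ gamma)%:C * (k * expi xi x).
Proof.
rewrite /Lgamma.
rewrite (_ : (fun z => _) = (fun z =>
    - (k * expi xi x) * increment_product xi xi z)); last first.
  apply/funext => z; rewrite increment_product_diag.
  by rewrite !expiD; ring.
rewrite levy_integralZ ?levy_integral_increment_product//; last first.
  exact: levy_integrable_increment_product.
rewrite /carre_du_champ_symbol subrr normr0 powR0 ?gt_eqF// subr0.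
by rewrite !(rmorphM, rmorphD)/= fmorphV rmorph_nat/=; field.
Qed.

Lemma carre_du_champ_kernel : is_kernel (carre_du_champ gamma)
  (fun xi eta => (carre_du_champ_symbol xi eta)%:C).
Proof.
move=> xi eta x; rewrite (expi_mul1 xi) (expi_mul1 eta).
by rewrite carre_du_champ_expi rmorph1 !mul1r.
Qed.

(** Each of the three terms of [Gamma_2] is [psi e_(xi - eta)] times an
    eigenvalue of the generator; with the signs of [Gamma_2], these add up to
    [- |xi - eta|^gamma + |eta|^gamma + |xi|^gamma = 2 psi]. *)
Lemma carre_du_champ2_kernel : is_kernel (carre_du_champ2 gamma)
  (fun xi eta => ((carre_du_champ_symbol xi eta) ^+ 2)%:C).
Proof.
move=> xi eta x; rewrite /carre_du_champ2.
have L t : Lgamma gamma (expi t) = (fun y => - (`|t| `^ gamma)%:C * expi t y).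
  by apply/funext => y; rewrite Lgamma_expi.
have -> : carre_du_champ gamma (expi xi) (expi eta) =
    (fun y => (carre_du_champ_symbol xi eta)%:C * expi (xi - eta) y).
  by apply/funext => y; rewrite carre_du_champ_kernel mulrC.
have El a : carre_du_champ gamma (fun y => a * expi xi y) (expi eta) x =
    a * expi (xi - eta) x * (carre_du_champ_symbol xi eta)%:C.
  by rewrite (expi_mul1 eta) carre_du_champ_expi rmorph1 mulr1.
have Er b : carre_du_champ gamma (expi xi) (fun y => b * expi eta y) x =
    b^* * expi (xi - eta) x * (carre_du_champ_symbol xi eta)%:C.
  by rewrite (expi_mul1 xi) carre_du_champ_expi mul1r.
rewrite Lgamma_expiZ !L El Er.
have conj_real (t : R) : Num.conj (- t%:C) = - t%:C.
  by rewrite rmorphN; congr (- _); exact: conjc_real.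
rewrite conj_real.
apply: (@mulfI _ 2); first by rewrite pnatr_eq0.
rewrite mulrA divff ?pnatr_eq0// mul1r.
transitivity ((carre_du_champ_symbol xi eta)%:C * expi (xi - eta) x *
  (2 * carre_du_champ_symbol xi eta)%:C).
  rewrite [2 * _](_ : _ =
    `|xi| `^ gamma + `|eta| `^ gamma - `|xi - eta| `^ gamma).
    by rewrite rmorphB rmorphD/=; ring.
  by rewrite /carre_du_champ_symbol; field.
by rewrite [(2 * _)%:C]rmorphM/= rmorph_nat rmorphXn/=; ring.
Qed.

End CarreDuChamp.

Lemma dist_norm_same_sign (R : realDomainType) (x y : R) : 0 <= x * y ->
  `| `|x| - `|y| | = `|x - y|.
Proof.
have [x0|x0|->] := ltgtP x 0; last by rewrite normr0 !sub0r !normrN normr_id.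
- rewrite nmulr_rge0// => y0.
  by rewrite (ltr0_norm x0) (ler0_norm y0) opprK addrC distrC.
- by rewrite pmulr_rge0// => y0; rewrite (gtr0_norm x0) (ger0_norm y0).
Qed.

Unset Implicit Arguments.

Theorem theoremA (R : realType) (gamma : R) (hgamma : 0 < gamma < 2) :
  [/\ is_kernel (carre_du_champ gamma) (Psi gamma),
      is_kernel (carre_du_champ2 gamma) (Phi2 gamma)
    & forall xi eta : R,
        Phi2 gamma xi eta = Psi gamma xi eta ^+ 2 /\
        (0 <= xi * eta ->
         Phi2 gamma xi eta = (fbm_cov (gamma / 2) `|xi| `|eta| ^+ 2)%:C)].
Proof.
have normalized := levy_normalized_const hgamma.
have /andP[gamma_gt0 _] := hgamma.
have K1 := carre_du_champ_kernel normalized.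
have K2 := carre_du_champ2_kernel gamma_gt0 normalized.
rewrite /Psi /Phi2 (is_kernel_unique K1) (is_kernel_unique K2).
split=> // xi eta; split; first by rewrite rmorphXn.
move=> sgn; congr ((_ ^+ 2)%:C).
rewrite /fbm_cov /carre_du_champ_symbol dist_norm_same_sign// !normr_id.
by rewrite mulrCA divff ?mulr1 ?pnatr_eq0.
Qed.
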